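(* Let $T$ be a $\mathbf{B}$-derivation whose root is labeled by the consecution $X\Rightarrow A$, let $d$ be a depth substitution, and let $n\in\mathbb{Z}$. Then $d^n(T)$ is again a $\mathbf{B}$-derivation, and its root is labeled by $d^n(X)\Rightarrow d^n(A)$.
   Context: Language. Fix a countably infinite set of atoms $\mathsf{At}=\{p_1,p_2,\dots\}$. Formulas are built from atoms by the unary connective $\neg$ and the binary connectives $\land,\lor,\to,\circ$. Bunches are built from formulas (which are the atomic bunches) by two binary operations, the comma $(X,Y)$ and the semicolon $(X;Y)$. A consecution is an expression $X\Rightarrow A$ with $X$ a bunch and $A$ a formula. The parsing tree of a bunch has the bunch at its root; a node $X;Y$, $X,Y$, $A\land B$, $A\lor B$, $A\to B$ or $A\circ B$ has children $X,Y$ (resp. $A,B$) in that order, a node $\neg A$ has the single child $A$, atoms are leaves. An occurrence of a subexpression is a node of this tree. $Y(X)$ denotes a bunch $Y$ with a distinguished occurrence of a subbunch $X$, and $Y(Z)$ the result of replacing that occurrence by the bunch $Z$. Depth. Annotate the parsing tree of a bunch with integers: the root gets $0$; if $X;Y$ gets $k$ then $X$ gets $k-1$ and $Y$ gets $k$; if $A\circ B$ gets $k$ then $A$ gets $k-1$ and $B$ gets $k$; if $A\to B$ gets $k$ then $A$ and $B$ both get $k+1$; children of $X,Y$, $A\land B$, $A\lor B$, $\neg A$ get the same number as the parent. The number annotating an occurrence is its depth. Depth substitutions. A depth substitution is a function $d:\mathbb{Z}\times\mathsf{At}\to$ formulas, written $d^n(p)$, extended to bunches by $d^n(\neg A)=\neg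 d^n(A)$, $d^n(A\land B)=d^n(A)\land d^n(B)$, $d^n(A\lor B)=d^n(A)\lor d^n(B)$, $d^n(A\to B)=d^{n+1}(A)\to d^{n+1}(B)$, $d^n(A\circ B)=d^{n-1}(A)\circ d^n(B)$, $d^n(X,Y)=d^n(X),d^n(Y)$, $d^n(X;Y)=d^{n-1}(X);d^n(Y)$. The rules of $\mathbf{B}$ (premises listed in order, then conclusion): (id): no premises, conclusion $A\Rightarrow A$. ($\to$I): $X;A\Rightarrow B$ / $X\Rightarrow A\to B$. ($\to$E): $X\Rightarrow A\to B$, $Y\Rightarrow A$ / $X;Y\Rightarrow B$. ($\lor$I$_1$): $X\Rightarrow A$ / $X\Rightarrow A\lor B$. ($\lor$I$_2$): $X\Rightarrow B$ / $X\Rightarrow A\lor B$. ($\lor$E): $X\Rightarrow A\lor B$, $Y(A)\Rightarrow C$, $Y(B)\Rightarrow C$ / $Y(X)\Rightarrow C$. ($\land$I): $X\Rightarrow A$, $Y\Rightarrow B$ / $X,Y\Rightarrow A\land B$. ($\land$E): $X\Rightarrow A\land B$, $Y(A,B)\Rightarrow C$ / $Y(X)\Rightarrow C$. ($\circ$I): $X\Rightarrow A$, $Y\Rightarrow B$ / $X;Y\Rightarrow A\circ B$. ($\circ$E): $X\Rightarrow A\circ B$, $Y(A;B)\Rightarrow C$ / $Y(X)\Rightarrow C$. ($\neg$I): $X\Rightarrow B$, $A\Rightarrow\neg B$ / $X\Rightarrow\neg A$. ($\neg$E): $X\Rightarrow\neg\neg A$ / $X\Rightarrow A$. (Cut): $X\Rightarrow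 A$, $Y(A)\Rightarrow B$ / $Y(X)\Rightarrow B$. Structural rules (with $W(\cdot)$ a distinguished occurrence): (eB) $W(X,(Y,Z))\Rightarrow A$ / $W((X,Y),Z)\Rightarrow A$; (eC) $W(X,Y)\Rightarrow A$ / $W(Y,X)\Rightarrow A$; (eW) $W(X,X)\Rightarrow A$ / $W(X)\Rightarrow A$; (eK) $W(X)\Rightarrow A$ / $W(X,Y)\Rightarrow A$. Derivations. A $\mathbf{B}$-pseudoderivation is a finite tree whose nodes are labeled by consecutions or rule names, whose root is a consecution node, in which consecution nodes are adjacent only to rule nodes, and in which a node labeled by a rule with $k$ premises is adjacent to exactly $k+1$ consecution nodes (one conclusion below, $k$ premises above). A $\mathbf{B}$-derivation is a pseudoderivation containing at least one rule node in which every rule node together with its neighbours is an instance of that rule (conclusion below, premises above in the rule's order). Consecution nodes that are leaves are open leaves. Action of $d$ on derivations. For $n\in\mathbb{Z}$, $d^n(T)$ is defined recursively. A single consecution node $X\Rightarrow A$ is sent to the node $d^n(X)\Rightarrow d^n(A)$; the (id) derivation of $A\Rightarrow A$ is sent to the (id) derivation of $d^n(A)\Rightarrow d^n(A)$. If $T$ ends with rule $R$ with conclusion $X\Rightarrow A$ and premise subtrees $S_1,\dots,S_k$, then $d^n(T)$ ends with rule $R$ with conclusion $d^n(X)\Rightarrow d^n(A)$ and premise subtrees $d^{n_1}(S_1),\dots,d^{n_k}(S_k)$, where: for ($\to$I), $n_1=n+1$; for ($\to$E) and ($\circ$I), $n_1=n-1$, $n_2=n$; for ($\lor$E), ($\land$E),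 ($\circ$E), (Cut), whose conclusion has the form $Y(X)\Rightarrow C$, $n_1=n+c$ where $c$ is the depth of the distinguished occurrence of $X$ in $Y(X)$, and all other $n_i=n$; for all remaining rules all $n_i=n$. In general $d^n(T)$ is a pseudoderivation. *)

(* Defs.v *)
From mathcomp Require Import all_boot all_order all_algebra.
Set Implicit Arguments. Unset Strict Implicit. Unset Printing Implicit Defensive.
Local Open Scope ring_scope.

Definition atom := nat.

Inductive formula : Type :=
| Atom of atom
| Neg of formula
| And of formula & formula
| Or of formula & formula
| Imp of formula & formula
| Fus of formula & formula.

Inductive bunch : Type :=
| Form of formula
| Comma of bunch & bunch
| Semi of bunch & bunch.

Inductive consecution : Type := Conseq of bunch & formula.

(* An occurrence is a node of the parsing tree, given by the path leading to it
   from the root; the only child of a negation is its left child. *)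
Inductive dir : Type := Lft | Rgt.
Definition occ := seq dir.

(* [formula_depth k A o] (resp. [depth_from k X o]) is the number annotating the
   node [o] of the parsing tree when the root gets [k], and [None] if there is
   no such node. *)
Fixpoint formula_depth (k : int) (A : formula) (o : occ) : option int :=
  match o, A with
  | [::], _ => Some k
  | Lft :: o', Neg B => formula_depth k B o'
  | Lft :: o', And B _ => formula_depth k B o'
  | Rgt :: o', And _ C => formula_depth k C o'
  | Lft :: o', Or B _ => formula_depth k B o'
  | Rgt :: o', Or _ C => formula_depth k C o'
  | Lft :: o', Imp B _ => formula_depth (k + 1) B o'
  | Rgt :: o', Imp _ C => formula_depth (k + 1) C o'
  | Lft :: o', Fus B _ => formula_depth (k - 1) B o'
  | Rgt :: o', Fus _ C => formula_depth k C o'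
  | _, _ => None
  end.

Fixpoint depth_from (k : int) (X : bunch) (o : occ) : option int :=
  match o, X with
  | _, Form A => formula_depth k A o
  | [::], _ => Some k
  | Lft :: o', Comma Y _ => depth_from k Y o'
  | Rgt :: o', Comma _ Z => depth_from k Z o'
  | Lft :: o', Semi Y _ => depth_from (k - 1) Y o'
  | Rgt :: o', Semi _ Z => depth_from k Z o'
  end.

Definition depth : bunch -> occ -> option int := depth_from 0.

(* Only nodes that are bunches (a formula being an atomic bunch) are occurrences
   of subbunches; nodes strictly inside a formula are not. *)
Fixpoint subbunch (Y : bunch) (o : occ) : option bunch :=
  match o, Y with
  | [::], _ => Some Y
  | Lft :: o', Comma Y1 _ | Lft :: o', Semi Y1 _ => subbunch Y1 o'
  | Rgt :: o', Comma _ Y2 | Rgt :: o', Semi _ Y2 => subbunch Y2 o'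
  | _, Form _ => None
  end.

(* If [subbunch Y o = Some X], then [Y] with the distinguished occurrence [o] is
   Y(X), and [replace Y o Z] is Y(Z). *)
Fixpoint replace (Y : bunch) (o : occ) (Z : bunch) : bunch :=
  match o, Y with
  | [::], _ => Z
  | Lft :: o', Comma Y1 Y2 => Comma (replace Y1 o' Z) Y2
  | Rgt :: o', Comma Y1 Y2 => Comma Y1 (replace Y2 o' Z)
  | Lft :: o', Semi Y1 Y2 => Semi (replace Y1 o' Z) Y2
  | Rgt :: o', Semi Y1 Y2 => Semi Y1 (replace Y2 o' Z)
  | _, Form _ => Y
  end.

Definition depth_subst := int -> atom -> formula.

Fixpoint dsub_formula (d : depth_subst) (n : int) (A : formula) : formula :=
  match A with
  | Atom p => d n p
  | Neg B => Neg (dsub_formula d n B)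
  | And B C => And (dsub_formula d n B) (dsub_formula d n C)
  | Or B C => Or (dsub_formula d n B) (dsub_formula d n C)
  | Imp B C => Imp (dsub_formula d (n + 1) B) (dsub_formula d (n + 1) C)
  | Fus B C => Fus (dsub_formula d (n - 1) B) (dsub_formula d n C)
  end.

Fixpoint dsub_bunch (d : depth_subst) (n : int) (X : bunch) : bunch :=
  match X with
  | Form A => Form (dsub_formula d n A)
  | Comma Y Z => Comma (dsub_bunch d n Y) (dsub_bunch d n Z)
  | Semi Y Z => Semi (dsub_bunch d (n - 1) Y) (dsub_bunch d n Z)
  end.

Definition dsub_conseq (d : depth_subst) (n : int) (c : consecution) :=
  let: Conseq X A := c in Conseq (dsub_bunch d n X) (dsub_formula d n A).

(* The rules whose transformation under a depth substitution depends on the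
   distinguished occurrence carry that occurrence: the consecutions alone need
   not determine it (e.g. in a cut with premise A => A). *)
Inductive rule : Type :=
| Id | ImpI | ImpE | OrI1 | OrI2 | OrE of occ | AndI | AndE of occ
| FusI | FusE of occ | NegI | NegE | Cut of occ | EB | EC | EW | EK.

Definition arity (r : rule) : nat :=
  match r with
  | Id => 0
  | ImpI | OrI1 | OrI2 | NegE | EB | EC | EW | EK => 1
  | ImpE | AndI | AndE _ | FusI | FusE _ | NegI | Cut _ => 2
  | OrE _ => 3
  end.

(* [instance r ps c]: premises [ps], in this order, and conclusion [c]. *)
Inductive instance : rule -> seq consecution -> consecution -> Prop :=
| InstId A : instance Id [::] (Conseq (Form A) A)
| InstImpI X A B :
    instance ImpI [:: Conseq (Semi X (Form A)) B] (Conseq X (Imp A B))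
| InstImpE X Y A B :
    instance ImpE [:: Conseq X (Imp A B); Conseq Y A] (Conseq (Semi X Y) B)
| InstOrI1 X A B : instance OrI1 [:: Conseq X A] (Conseq X (Or A B))
| InstOrI2 X A B : instance OrI2 [:: Conseq X B] (Conseq X (Or A B))
| InstOrE Y o X A B C : subbunch Y o = Some X ->
    instance (OrE o)
      [:: Conseq X (Or A B); Conseq (replace Y o (Form A)) C;
          Conseq (replace Y o (Form B)) C]
      (Conseq Y C)
| InstAndI X Y A B :
    instance AndI [:: Conseq X A; Conseq Y B] (Conseq (Comma X Y) (And A B))
| InstAndE Y o X A B C : subbunch Y o = Some X ->
    instance (AndE o)
      [:: Conseq X (And A B);
          Conseq (replace Y o (Comma (Form A) (Form B))) C]
      (Conseq Y C)
| InstFusI X Y A B :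
    instance FusI [:: Conseq X A; Conseq Y B] (Conseq (Semi X Y) (Fus A B))
| InstFusE Y o X A B C : subbunch Y o = Some X ->
    instance (FusE o)
      [:: Conseq X (Fus A B);
          Conseq (replace Y o (Semi (Form A) (Form B))) C]
      (Conseq Y C)
| InstNegI X A B :
    instance NegI [:: Conseq X B; Conseq (Form A) (Neg B)] (Conseq X (Neg A))
| InstNegE X A : instance NegE [:: Conseq X (Neg (Neg A))] (Conseq X A)
| InstCut Y o X A B : subbunch Y o = Some X ->
    instance (Cut o)
      [:: Conseq X A; Conseq (replace Y o (Form A)) B] (Conseq Y B)
| InstEB W o X Y Z A : subbunch W o = Some (Comma (Comma X Y) Z) ->
    instance EB
      [:: Conseq (replace W o (Comma X (Comma Y Z))) A] (Conseq W A)
| InstEC W o X Y A : subbunch W o = Some (Comma Y X) ->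
    instance EC [:: Conseq (replace W o (Comma X Y)) A] (Conseq W A)
| InstEW W o X A : subbunch W o = Some X ->
    instance EW [:: Conseq (replace W o (Comma X X)) A] (Conseq W A)
| InstEK W o X Y A : subbunch W o = Some (Comma X Y) ->
    instance EK [:: Conseq (replace W o X) A] (Conseq W A).

(* [Infer r c ts] is a consecution node [c] with a rule node [r] above it, whose
   premises are the roots of [ts]; [Open c] is an open leaf. *)
Inductive tree : Type :=
| Open of consecution
| Infer of rule & consecution & seq tree.

Definition root_label (T : tree) : consecution :=
  match T with Open c => c | Infer _ c _ => c end.

Fixpoint every_rule_node (P : rule -> seq consecution -> consecution -> Prop)
    (T : tree) : Prop :=
  match T with
  | Open _ => True
  | Infer r c ts =>
      P r [seq root_label t | t <- ts] c /\
      foldr (fun t Q => every_rule_node P t /\ Q) True ts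
  end.

Definition has_rule_node (T : tree) : bool :=
  if T is Infer _ _ _ then true else false.

Definition pseudoderivation (T : tree) : Prop :=
  every_rule_node (fun r ps _ => size ps = arity r) T.

Definition derivation (T : tree) : Prop :=
  [/\ pseudoderivation T, has_rule_node T & every_rule_node instance T].

(* The difference n_i - n for the premise of index [i] (counted from 0) of a rule
   [r] whose conclusion has antecedent [Y]. The default value 0 is only used in
   trees that are not derivations. *)
Definition premise_shift (r : rule) (Y : bunch) (i : nat) : int :=
  match r, i with
  | ImpI, 0%N => 1
  | ImpE, 0%N | FusI, 0%N => -1
  | OrE o, 0%N | AndE o, 0%N | FusE o, 0%N | Cut o, 0%N => odflt 0 (depth Y o)
  | _, _ => 0
  end.

Definition mapi (U V : Type) (f : nat -> U -> V) : nat -> seq U -> seq V :=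
  fix go i s := if s is x :: s' then f i x :: go i.+1 s' else [::].

Fixpoint dsub_tree (d : depth_subst) (n : int) (T : tree) : tree :=
  match T with
  | Open c => Open (dsub_conseq d n c)
  | Infer r (Conseq X A as c) ts =>
      Infer r (dsub_conseq d n c)
        (mapi (fun i t => dsub_tree d (n + premise_shift r X i) t) 0 ts)
  end.

(* Main.v *)
From mathcomp Require Import all_boot all_order all_algebra.
Require Import Defs.
From mathcomp Require Import ssrint.
Set Implicit Arguments. Unset Strict Implicit. Unset Printing Implicit Defensive.
Import GRing.Theory.
Local Open Scope ring_scope.

(** An occurrence of depth [c] in [Y] sits at level [n + c] when [Y] is
    transformed at level [n], so d^n(Y(X)) is d^n(Y) with d^(n+c)(X) at the same
    occurrence.  Hence d^n carries each instance of a rule to an instance of the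
    same rule, provided the premises are transformed at the shifted levels n_i;
    the result for derivations follows by applying this at every rule node. *)

Lemma depth_from_nil k X : depth_from k X [::] = Some k.
Proof. by case: X => [[]|X Y|X Y]. Qed.

(** Only the left branches of semicolons met along [o] change the level, each by -1, so the total
    shift [c] does not depend on the starting level. *)
Lemma subbunch_depth Y o X : subbunch Y o = Some X ->
  exists c, forall k, depth_from k Y o = Some (k + c).
Proof.
elim: Y o => [A|Y IHY Z IHZ|Y IHY Z IHZ] [|[] o] //;
  try by exists 0 => k; rewrite depth_from_nil addr0.
- exact: IHY.
- exact: IHZ.
- by case/IHY=> c Hc; exists (-1 + c) => k; rewrite /= Hc addrA.
- exact: IHZ.
Qed.

Lemma depth_from_depth n Y o X : subbunch Y o = Some X ->
  depth_from n Y o = Some (n + odflt 0 (depth Y o)).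
Proof. by case/subbunch_depth=> c Hc; rewrite /depth !Hc add0r. Qed.

(** Naming the level [m] instead of writing it as [n] plus a depth lets the induction pass under a
    semicolon without arithmetic. *)
Lemma subbunch_dsub d n m Y o X :
  subbunch Y o = Some X -> depth_from n Y o = Some m ->
  subbunch (dsub_bunch d n Y) o = Some (dsub_bunch d m X).
Proof.
elim: Y n o => [A|Y IHY Z IHZ|Y IHY Z IHZ] n [|[] o] //;
  try by rewrite depth_from_nil => -[<-] [<-].
- exact: IHY.
- exact: IHZ.
- exact: IHY.
- exact: IHZ.
Qed.

Lemma replace_dsub d n m Y o X Z :
  subbunch Y o = Some X -> depth_from n Y o = Some m ->
  dsub_bunch d n (replace Y o Z) = replace (dsub_bunch d n Y) o (dsub_bunch d m Z).
Proof.
elim: Y n o => [A|Y IHY W IHW|Y IHY W IHW] n [|[] o] //;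
  try by rewrite depth_from_nil => _ [<-].
- by move=> /= sX dm; rewrite (IHY _ _ sX dm).
- by move=> /= sX dm; rewrite (IHW _ _ sX dm).
- by move=> /= sX dm; rewrite (IHY _ _ sX dm).
- by move=> /= sX dm; rewrite (IHW _ _ sX dm).
Qed.

Lemma instance_dsub d (n : int) r ps Y C : instance r ps (Conseq Y C) ->
  instance r
    (mapi (fun i c => dsub_conseq d (n + premise_shift r Y i) c) 0 ps)
    (dsub_conseq d n (Conseq Y C)).
Proof.
move E: (Conseq Y C) => c inst.
case: inst E => [A|X A B|X Z A B|X A B|X A B|Z o X A B D sX|X Z A B|Z o X A B D sX
  |X Z A B|Z o X A B D sX|X A B|X A|Z o X A B sX|W o X Z V A sX|W o X Z A sX
  (* The shifts +1 of [ImpI] and -1 of [ImpE] cancel against the -1 of a semicolon and the +1 of an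
     implication, respectively. *)
  |W o X A sX|W o X Z A sX] [-> _] /=; rewrite ?addr0 ?addrK ?subrK;
  try have dX := depth_from_depth n sX;
  try rewrite !(replace_dsub d _ sX dX) /=;
  try have := subbunch_dsub d sX dX;
  try by constructor.
(* The bunch discarded by [EK] occurs only in the side condition, so [constructor] cannot infer
   it. *)
by rewrite /= => sX'; apply: InstEK sX'.
Qed.

Lemma instance_arity r ps c : instance r ps c -> size ps = arity r.
Proof. by case. Qed.

(* The generated induction principle gives no hypothesis on the subtrees. *)
Lemma tree_nested_ind (P : tree -> Prop) :
  (forall c, P (Open c)) ->
  (forall r c ts, foldr (fun t Q => P t /\ Q) True ts -> P (Infer r c ts)) ->
  forall T, P T.
Proof.
move=> PO PI; fix IH 1 => -[c|r c ts]; first exact: PO.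
by apply: PI; elim: ts => [|t ts IHts]; [exact: I | split; [exact: IH |]].
Qed.

Lemma every_rule_node_impl (P Q : rule -> seq consecution -> consecution -> Prop) :
  (forall r ps c, P r ps c -> Q r ps c) ->
  forall T, every_rule_node P T -> every_rule_node Q T.
Proof.
move=> PQ; elim/tree_nested_ind => //= r c ts IH [/PQ Qr Pts]; split=> //.
elim: ts IH Pts {Qr} => //= t ts IHts [IHt /IHts{}IHts] [/IHt Qt /IHts Qts].
by split.
Qed.

Lemma root_label_dsub d n T :
  root_label (dsub_tree d n T) = dsub_conseq d n (root_label T).
Proof. by case: T => [//|r [X A] ts]. Qed.

(** The level is quantified after the tree because each premise is transformed at its own level. *)
Lemma every_instance_dsub d T : every_rule_node instance T ->
  forall n, every_rule_node instance (dsub_tree d n T).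
Proof.
elim/tree_nested_ind: T => //= r [X A] ts IH [inst Hts] n /=; split.
  have := instance_dsub d n inst; congr (instance _ _ _).
  (* The starting index of [mapi] must be general, as it grows along the list. *)
  elim: ts (0%N) {IH inst Hts} => //= t ts IHts i.
  by rewrite IHts root_label_dsub.
elim: ts (0%N) IH Hts {inst} => //= t ts IHts i [IHt IH] [Ht Hts].
by split; [exact: IHt | exact: IHts].
Qed.

Theorem theorem20 (T : tree) (X : bunch) (A : formula) (d : depth_subst)
    (n : int) :
  derivation T -> root_label T = Conseq X A ->
  derivation (dsub_tree d n T) /\
  root_label (dsub_tree d n T) = Conseq (dsub_bunch d n X) (dsub_formula d n A).
Proof.
case=> _ ruleT instT rootT; rewrite root_label_dsub rootT; split=> //.
have inst := every_instance_dsub d instT n; split=> //.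
- by apply: every_rule_node_impl inst => r ps c /instance_arity.
- by case: T ruleT {instT rootT inst} => // r [].
Qed.
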